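(* Let $K$ be a field with $\operatorname{char}(K)=0$ or $\operatorname{char}(K)\not\equiv 1,2 \pmod 4$, and let $G$ be a finite simple graph on $[n]$. Then the ideal $L_{\overline{G}}\subset K[x_1,\ldots,x_n,y_1,\ldots,y_n]$ is prime if and only if $G$ is $(n-2)$-connected.
   Context: The graph $\overline{G}$ is the complementary graph of $G$ on $[n]=\{1,\ldots,n\}$, and $L_{\overline{G}}=(x_ix_j+y_iy_j:\{i,j\}\in E(\overline{G}))$ (this is the case $d=2$ of the ideal of orthogonal representations of $G$ in $K^d$). A graph is $k$-connected if it has more than $k$ vertices and remains connected after deletion of any set of fewer than $k$ vertices (for $k\le 0$ the condition on deletions is vacuous). *)

(* Defs.v *)
From mathcomp Require Import all_boot all_order all_algebra.
From mathcomp Require Import ring_quotient boolp mpoly.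

Set Implicit Arguments.
Unset Strict Implicit.
Unset Printing Implicit Defensive.

Import Order.TTheory GRing.Theory Num.Theory.
Local Open Scope ring_scope.

(* A finite simple graph on T is a symmetric irreflexive relation on T. *)
Definition compl_graph (T : finType) (e : rel T) : rel T :=
  [rel x y | (x != y) && ~~ e x y].

Definition connected_off (T : finType) (e : rel T) (S : {set T}) : Prop :=
  forall x y : T, x \notin S -> y \notin S ->
    connect [rel u v | [&& u \notin S, v \notin S & e u v]] x y.

(* k is an integer, so that k = n - 2 keeps its sign when n < 2.  The size
   condition makes every T minus S considered here nonempty. *)
Definition k_connected (T : finType) (e : rel T) (k : int) : Prop :=
  (k < #|T|%:Z) /\
  (forall S : {set T}, #|S|%:Z < k -> connected_off e S).

Definition ideal_gen (R : comNzRingType) (I : finType) (P : pred I)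
    (f : I -> R) : {pred R} :=
  [pred p : R | `[< exists c : I -> R, p = \sum_(i | P i) c i * f i >]].

(* idealr_closed includes 1 \notin S, so a prime ideal is proper. *)
Definition is_prime_ideal (R : comNzRingType) (S : {pred R}) : Prop :=
  idealr_closed S /\ prime_idealr_closed S.

(* In {mpoly K[n + n]} the first n variables are x_1, ..., x_n and the last n
   are y_1, ..., y_n. *)
Definition xvar (K : fieldType) (n : nat) (i : 'I_n) : {mpoly K[n + n]} :=
  'X_(lshift n i).
Definition yvar (K : fieldType) (n : nat) (i : 'I_n) : {mpoly K[n + n]} :=
  'X_(rshift n i).

(* Each edge {i, j} is listed as both (i, j) and (j, i), which give the same
   generator. *)
Definition L_ideal (K : fieldType) (n : nat) (h : rel 'I_n) :
    {pred {mpoly K[n + n]}} :=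
  ideal_gen (fun ij : 'I_n * 'I_n => h ij.1 ij.2)
    (fun ij => xvar K ij.1 * xvar K ij.2 + yvar K ij.1 * yvar K ij.2).
Arguments L_ideal K n h : clear implicits.

(* Main.v *)
Require Import Defs.
From mathcomp Require Import all_boot all_order all_algebra.
From mathcomp Require Import ring_quotient boolp mpoly.
From mathcomp Require Import ring zify.

Set Implicit Arguments.
Unset Strict Implicit.
Unset Printing Implicit Defensive.

Import Order.TTheory GRing.Theory Num.Theory.
Local Open Scope ring_scope.

(** Write H for the complement of G. Both sides of the equivalence say that H
    is a matching, i.e. that no vertex has two distinct H-neighbours.

    Connectivity. Deleting fewer than n - 2 vertices leaves at least three. If
    j has two H-neighbours i and k, deleting everything else isolates j in G.
    If H is a matching and x, y are not adjacent in G, any third remaining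
    vertex is adjacent in G to both.

    Prime implies matching. If i and k are H-neighbours of j, the identity
      x_j (x_i y_k - x_k y_i)
        = y_k (x_j x_i + y_j y_i) - y_i (x_j x_k + y_j y_k)
    puts a product in the ideal L. Neither factor is in L: each takes the value
    1 at some K-point of the zero set of L, namely at a family of vectors of
    K^2 in which H-adjacent vertices receive orthogonal vectors.

    Matching implies prime. For an edge {i, j}, the relation
    x_i x_j + y_i y_j = 0 says that the 2 x 2 matrix with rows (x_i, y_i) and
    (y_j, - x_j) is singular, so it is the equation of a Segre variety and is
    parametrized by matrices u v^T. Doing this for all edges at once gives a
    morphism [segre] from the polynomial ring to itself, sending variables to
    signed monomials and killing L. Its kernel is exactly L: modulo L every
    polynomial is a combination of monomials divisible by no x_i x_j with
    {i, j} an edge ([standard_congr]), and [segre] maps distinct monomials of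
    this kind to distinct monomials, up to sign ([segre_mnm_inj]). A kernel of
    a morphism to a domain is prime. *)

(** * Connectivity of a graph and matchings in its complement *)

Definition is_matching (T : eqType) (h : rel T) : Prop :=
  forall i j k : T, h i j -> h i k -> j = k.

(** The sets S to delete are those leaving at least three vertices, so the
    condition only concerns triples: a cherry in the complement is a triple in
    which the centre is isolated, and otherwise any third vertex joins two
    non-adjacent ones. *)
Lemma k_connected_codim2P (T : finType) (e : rel T) :
  ssrbool.symmetric e -> irreflexive e ->
  k_connected e (#|T|%:Z - 2%:Z) <-> is_matching (compl_graph e).
Proof.
move=> e_sym e_irr; split=> [[_ e_conn] i j k | e_match].
  move=> /andP[ij /negbTE Nij] /andP[ik /negbTE Nik].
  apply/eqP; apply/negPn/negP => jk.
  pose S := ~: [set i; j; k].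
  have card_S : (#|S| + 3 = #|T|)%N.
    rewrite -(cardsC [set i; j; k]) addnC; congr (_ + _)%N.
    rewrite setUC cardsU1 !inE cards2 ij.
    by rewrite ![k == _]eq_sym (negbTE ik) (negbTE jk).
  (* The first step of a path from i to j would have to stay in {i, j, k}. *)
  have /connectP[[|y p] /= path_p last_p] : connect
      [rel u v | [&& u \notin S, v \notin S & e u v]] i j.
    apply: e_conn; rewrite ?inE ?eqxx ?orbT //.
    by rewrite -card_S PoszD; lia.
    by rewrite last_p eqxx in ij.
  case/andP: path_p => /and3P[_]; rewrite !inE negbK.
  by case/orP=> [/orP[]|] /eqP->; rewrite ?e_irr ?Nij ?Nik.
split=> [|S card_S x y xS yS]; first by lia.
have [->|xy] := eqVneq x y; first exact: connect0.
have [exy|Nexy] := boolP (e x y); first by apply: connect1; rewrite /= xS yS.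
have [z zS] : exists z, z \in ~: (S :|: [set x; y]).
  apply/set0Pn; rewrite -card_gt0 cardsCs setCK.
  have := cardsU S [set x; y]; rewrite cards2; lia.
move: zS; rewrite !inE !negb_or => /and3P[zS zx zy].
have e_xz : e x z.
  apply: contraNT zy => Nexz; apply/eqP/(e_match x); apply/andP; split=> //.
  by rewrite eq_sym.
have e_zy : e z y.
  rewrite e_sym; apply: contraNT zx => Neyz; apply/eqP/(e_match y); apply/andP.
    by rewrite eq_sym.
  by rewrite eq_sym e_sym.
by apply: (@connect_trans _ _ z); apply: connect1; rewrite /= ?xS ?yS ?zS.
Qed.

(** * Finitely generated ideals *)

Lemma ideal_genP (R : comNzRingType) (I : finType) (P : pred I) (f : I -> R) p :
  reflect (exists c : I -> R, p = \sum_(i | P i) c i * f i)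
          (p \in ideal_gen P f).
Proof. exact: asboolP. Qed.

Lemma mem_ideal_gen (R : comNzRingType) (I : finType) (P : pred I)
  (f : I -> R) i : P i -> f i \in ideal_gen P f.
Proof.
move=> Pi; apply/ideal_genP; exists (fun j => (j == i)%:R).
rewrite (bigD1 i) //= eqxx mul1r big1 ?addr0 // => j /andP[_ /negbTE->].
by rewrite mul0r.
Qed.

Lemma ideal_gen0 (R : comNzRingType) (I : finType) (P : pred I) (f : I -> R) :
  0 \in ideal_gen P f.
Proof.
by apply/ideal_genP; exists (fun=> 0); rewrite big1 // => i _; rewrite mul0r.
Qed.

Lemma ideal_genMD (R : comNzRingType) (I : finType) (P : pred I) (f : I -> R)
  (a u v : R) :
  u \in ideal_gen P f -> v \in ideal_gen P f -> a * u + v \in ideal_gen P f.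
Proof.
move=> /ideal_genP[c ->] /ideal_genP[d ->]; apply/ideal_genP.
exists (fun i => a * c i + d i).
rewrite mulr_sumr -big_split; apply: eq_bigr => i _ /=.
by rewrite mulrDl mulrA.
Qed.

Lemma ideal_genM (R : comNzRingType) (I : finType) (P : pred I) (f : I -> R)
  (a u : R) : u \in ideal_gen P f -> a * u \in ideal_gen P f.
Proof. by move=> u_in; rewrite -[_ * _]addr0 ideal_genMD ?ideal_gen0. Qed.

Lemma rmorph_ideal_gen0 (R S : comNzRingType) (phi : {rmorphism R -> S})
  (I : finType) (P : pred I) (f : I -> R) :
  (forall i, P i -> phi (f i) = 0) ->
  {in ideal_gen P f, forall p : R, phi p = 0}.
Proof.
move=> phi0 p /ideal_genP[c ->]; rewrite rmorph_sum big1 // => i Pi.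
by rewrite rmorphM phi0 ?mulr0.
Qed.

Lemma ker_prime_ideal (R : comNzRingType) (D : idomainType)
  (phi : {rmorphism R -> D}) (S : {pred R}) :
  (forall p, (p \in S) = (phi p == 0)) -> is_prime_ideal S.
Proof.
move=> S_ker; split; last by move=> u v; rewrite !S_ker rmorphM mulf_eq0.
split=> [||a u v]; rewrite !S_ker ?rmorph0 ?rmorph1 ?oner_eq0 //.
by move=> /eqP u0 /eqP v0; rewrite rmorphD rmorphM u0 v0 mulr0 addr0.
Qed.

(** * Prime ideals force a matching *)

Definition point (K : fieldType) (n : nat) (a b : 'I_n -> K) :
  'I_(n + n) -> K :=
  fun k => match split k with inl i => a i | inr i => b i end.

Lemma meval_xvar (K : fieldType) n (a b : 'I_n -> K) i :
  (xvar K i).@[point a b] = a i.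
Proof. by rewrite mevalXU /point (unsplitK (inl i)). Qed.

Lemma meval_yvar (K : fieldType) n (a b : 'I_n -> K) i :
  (yvar K i).@[point a b] = b i.
Proof. by rewrite mevalXU /point (unsplitK (inr i)). Qed.

Lemma L_ideal_vanish (K : fieldType) n (h : rel 'I_n) (a b : 'I_n -> K) :
  (forall i j, h i j -> a i * a j + b i * b j = 0) ->
  {in L_ideal K n h, forall p : {mpoly K[n + n]}, p.@[point a b] = 0}.
Proof.
move=> orth; apply: rmorph_ideal_gen0 => -[i j] /= /orth.
by rewrite rmorphD !rmorphM /= !meval_xvar !meval_yvar.
Qed.

(** L vanishes at every family of vectors of K^2 that is orthogonal along the
    edges, so a polynomial not vanishing at one such family is not in L. This
    excludes both factors of x_j (x_i y_k - x_k y_i), which is in L. *)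
Lemma prime_L_ideal_matching (K : fieldType) n (h : rel 'I_n) :
  ssrbool.symmetric h -> irreflexive h ->
  is_prime_ideal (L_ideal K n h) -> is_matching h.
Proof.
move=> h_sym h_irr [_ L_prime] j i k ji jk.
apply/eqP; apply/negPn/negP => ik.
have : xvar K j * (xvar K i * yvar K k - xvar K k * yvar K i) \in L_ideal K n h.
  have -> : xvar K j * (xvar K i * yvar K k - xvar K k * yvar K i) =
      yvar K k * (xvar K j * xvar K i + yvar K j * yvar K i) +
      (- yvar K i) * (xvar K j * xvar K k + yvar K j * yvar K k) by ring.
  apply: ideal_genMD; last apply: ideal_genM.
    exact: (mem_ideal_gen _ (i := (j, i))).
  exact: (mem_ideal_gen _ (i := (j, k))).
case/L_prime/orP.
  (* All vectors are 0, except (1, 0) at j. *)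
  have orth_j u v : h u v -> (u == j)%:R * (v == j)%:R + 0 * 0 = 0 :> K.
    move=> uv; rewrite mulr0 addr0 -natrM mulnb.
    suff -> : (u == j) && (v == j) = false by [].
    by apply: contraTF uv => /andP[/eqP-> /eqP->]; rewrite h_irr.
  move=> /(L_ideal_vanish orth_j)/eqP.
  by rewrite meval_xvar eqxx oner_eq0.
(* All vectors are 0, except (1, 0) at i and (0, 1) at k. *)
have orth_ik u v : h u v ->
    (u == i)%:R * (v == i)%:R + (u == k)%:R * (v == k)%:R = 0 :> K.
  move=> uv; rewrite -!natrM !mulnb.
  have not_both l : (u == l) && (v == l) = false.
    by apply: contraTF uv => /andP[/eqP-> /eqP->]; rewrite h_irr.
  by rewrite !not_both addr0.
move=> /(L_ideal_vanish orth_ik)/eqP.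
rewrite rmorphB !rmorphM /= !meval_xvar !meval_yvar !eqxx.
by rewrite (negbTE ik) mulr0 subr0 mulr1 oner_eq0.
Qed.

(** * The Segre parametrization of a matching *)

(** A matching is encoded by the involution exchanging the ends of each edge
    and fixing the unmatched vertices. *)
Lemma matching_involution (T : finType) (h : rel T) :
  ssrbool.symmetric h -> irreflexive h -> is_matching h ->
  exists2 s : T -> T, involutive s & forall i j, h i j = (i != j) && (s i == j).
Proof.
move=> h_sym h_irr h_match.
pose s i := odflt i [pick j | h i j].
have sP i j : h i j -> s i = j.
  rewrite /s; case: pickP => [k /= hik hij|->//]; exact: h_match hij.
have s_edge i : s i != i -> h i (s i).
  by rewrite /s; case: pickP => //=; rewrite eqxx.
exists s => [i|i j].
  have [si|/s_edge] := eqVneq (s i) i; first by rewrite !si.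
  by rewrite h_sym => /sP.
apply/idP/andP=> [hij|[ij /eqP sij]]; last first.
  by rewrite -sij s_edge // sij eq_sym.
rewrite (sP i j) // eqxx; split=> //.
by apply: contraTneq hij => ->; rewrite h_irr.
Qed.

(** Exponents of the parametrization: x_i goes to x_i y_i and y_i to
    x_i y_(s i), up to sign, when i is matched. So for an edge {i, j} the
    variables x_i, x_j serve as scalars and (y_i, y_j) as the common direction.
    For an unmatched i the images are x_i y_i and x_i, whose powers are
    independent as well; this keeps one formula for all vertices. *)
Definition segre_exp n (s : 'I_n -> 'I_n) (k : 'I_(n + n)) : 'X_{1..n + n} :=
  match split k with
  | inl i => (U_(lshift n i) + U_(rshift n i))%MM
  | inr i => (U_(lshift n i) + U_(rshift n (s i)) *+ (s i != i))%MM
  end.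

(** Of the two ends of an edge exactly one gets the sign -1, so that the two
    terms of the generator cancel. *)
Definition segre_sign (K : fieldType) n (s : 'I_n -> 'I_n)
    (k : 'I_(n + n)) : K :=
  match split k with inl _ => 1 | inr i => (-1) ^+ (s i < i)%N end.

Definition segre (K : fieldType) n (s : 'I_n -> 'I_n) :
    {rmorphism {mpoly K[n + n]} -> {mpoly K[n + n]}} :=
  mmap (@mpolyC (n + n) K)
       (fun k => segre_sign K s k *: 'X_[segre_exp s k]).

Definition segre_mnm n (s : 'I_n -> 'I_n) (m : 'X_{1..n + n}) : 'X_{1..n + n} :=
  (\sum_(k < n + n) segre_exp s k *+ m k)%MM.

Definition segre_coef (K : fieldType) n (s : 'I_n -> 'I_n)
    (m : 'X_{1..n + n}) : K :=
  \prod_k segre_sign K s k ^+ m k.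

Lemma segre_coef_neq0 (K : fieldType) n (s : 'I_n -> 'I_n) m :
  segre_coef K s m != 0.
Proof.
apply/prodf_neq0 => k _; rewrite expf_neq0 // /segre_sign.
by case: split => [_|i]; rewrite ?oner_eq0 // signr_eq0.
Qed.

Lemma segreX (K : fieldType) n (s : 'I_n -> 'I_n) m :
  segre K s 'X_[m] = segre_coef K s m *: 'X_[segre_mnm s m].
Proof.
rewrite /segre /= mmapX /mmap1 /segre_mnm /segre_coef.
rewrite (big_morph (fun m => 'X_[m]) (@mpolyXD _ _) (@mpolyX0 _ _)).
rewrite -scaler_prod.
by apply: eq_bigr => k _; rewrite exprZn mpolyXn.
Qed.

Lemma segreZ (K : fieldType) n (s : 'I_n -> 'I_n) (c : K) p :
  segre K s (c *: p) = c *: segre K s p.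
Proof. by rewrite /segre /= mmapZ mul_mpolyC. Qed.

Lemma segre_generator (K : fieldType) n (s : 'I_n -> 'I_n) i :
  involutive s -> i != s i ->
  segre K s (xvar K i * xvar K (s i) + yvar K i * yvar K (s i)) = 0.
Proof.
move=> sK isi; rewrite rmorphD !rmorphM /= /xvar /yvar !mmapX !mmap1U.
rewrite /segre_sign /segre_exp !(unsplitK (inl _)) !(unsplitK (inr _)).
rewrite sK isi [s i == i]eq_sym isi !mulm1n !scale1r.
rewrite -!scalerAl -!scalerAr !scalerA -!mpolyXD.
set m := (X in 'X_[X] + _); set m' := (X in _ *: 'X_[X]).
have -> : m' = m by apply/mnmP => k; rewrite !mnmDE; lia.
have -> : (-1) ^+ (s i < i)%N * (-1) ^+ (i < s i)%N = -1 :> K.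
  by rewrite -val_eqE /= neq_ltn in isi; case/orP: isi => isi;
    rewrite isi ltnNge ltnW // ?mulr1 ?mul1r.
by rewrite scaleN1r subrr.
Qed.

Lemma segre_mnm_x n (s : 'I_n -> 'I_n) m j :
  segre_mnm s m (lshift n j) = (m (lshift n j) + m (rshift n j))%N.
Proof.
rewrite /segre_mnm mnm_sumE big_split_ord /=; congr (_ + _)%N.
  rewrite (bigD1 j) //= big1 => [|i ij];
    rewrite mulmnE /segre_exp (unsplitK (inl _)).
    by rewrite mnmDE !mnm1E eqxx eq_rlshift mul1n addn0.
  by rewrite mnmDE !mnm1E eq_lshift (negbTE ij) eq_rlshift.
rewrite (bigD1 j) //= big1 => [|i ij];
    rewrite mulmnE /segre_exp (unsplitK (inr _)).
  by rewrite mnmDE mulmnE !mnm1E eqxx eq_rlshift mul1n addn0.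
by rewrite mnmDE mulmnE !mnm1E eq_lshift (negbTE ij) eq_rlshift.
Qed.

Lemma segre_mnm_y n (s : 'I_n -> 'I_n) m j : involutive s ->
  segre_mnm s m (rshift n j) =
    (m (lshift n j) + (s j != j) * m (rshift n (s j)))%N.
Proof.
move=> sK; rewrite /segre_mnm mnm_sumE big_split_ord /=; congr (_ + _)%N.
  rewrite (bigD1 j) //= big1 => [|i ij];
    rewrite mulmnE /segre_exp (unsplitK (inl _)).
    by rewrite mnmDE !mnm1E eqxx eq_lrshift mul1n addn0.
  by rewrite mnmDE !mnm1E eq_rshift (negbTE ij) eq_lrshift.
rewrite (bigD1 (s j)) //= big1 => [|i ij];
    rewrite mulmnE /segre_exp (unsplitK (inr _)).
  by rewrite mnmDE mulmnE !mnm1E sK eqxx eq_lrshift mul1n addn0 eq_sym.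
rewrite mnmDE mulmnE !mnm1E eq_lrshift eq_rshift.
by rewrite -(inj_eq (can_inj sK)) sK (negbTE ij).
Qed.

(** Monomials that are irreducible for the rewriting rule
    x_i x_(s i) -> - y_i y_(s i). *)
Definition standard n (s : 'I_n -> 'I_n) (m : 'X_{1..n + n}) : bool :=
  [forall i, (s i != i) ==> (m (lshift n i) * m (lshift n (s i)) == 0)%N].

(** For an edge {i, j}, the image determines x_i + y_i, x_j + y_j, x_i + y_j
    and x_j + y_i (letters standing for exponents), hence x_i - x_j. One of
    x_i, x_j vanishes, so this difference determines both. *)
Lemma segre_mnm_inj n (s : 'I_n -> 'I_n) : involutive s ->
  {in standard s &, injective (segre_mnm s)}.
Proof.
move=> sK m m' /forallP m_std /forallP m'_std eq_mm'.
have eq_x i : (m (lshift n i) + m (rshift n i) =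
               m' (lshift n i) + m' (rshift n i))%N.
  by rewrite -!(segre_mnm_x s) eq_mm'.
have eq_y i : (m (lshift n i) + (s i != i) * m (rshift n (s i)) =
               m' (lshift n i) + (s i != i) * m' (rshift n (s i)))%N.
  by rewrite -!segre_mnm_y // eq_mm'.
suff eq_l i : m (lshift n i) = m' (lshift n i).
  apply/mnmP => k; case: (split_ordP k) => i -> //.
  by have := eq_x i; rewrite eq_l => /addnI.
have := eq_y i; have := eq_x (s i); have := m_std i; have := m'_std i.
case: (s i != i) => /=; last by rewrite !addn0.
rewrite !muln_eq0; lia.
Qed.

(** Each use of the rewriting rule x_i x_(s i) -> - y_i y_(s i) lowers the
    total degree in the x variables, so rewriting terminates. *)
Lemma standard_congr_mnm (K : fieldType) n (h : rel 'I_n) (s : 'I_n -> 'I_n) :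
  (forall i, s i != i -> h i (s i)) ->
  forall m, exists c m', standard s m' /\
    'X_[m] - c *: 'X_[m'] \in L_ideal K n h.
Proof.
move=> s_edge m.
have [d] := ubnP (\sum_i m (lshift n i))%N; elim: d m => // d IHd m lt_m_d.
have [m_std|] := boolP (standard s m).
  by exists 1, m; rewrite scale1r subrr ideal_gen0.
rewrite negb_forall => /existsP[i]; rewrite negb_imply muln_eq0 negb_or.
case/and3P=> si mi msi.
pose g := (U_(lshift n i) + U_(lshift n (s i)))%MM.
pose m' := (m - g + (U_(rshift n i) + U_(rshift n (s i))))%MM.
have le_gm : (g <= m)%MM.
  apply/mnm_lepP => k; rewrite mnmDE !mnm1E.
  have [<-|_] := eqVneq (lshift n i) k.
    by rewrite eq_lshift (negbTE si) addn0 lt0n.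
  by have [<-|_] := eqVneq (lshift n (s i)) k; rewrite ?lt0n.
have [|c [m'' [m''_std m''_L]]] := IHd m'.
  have m'E j : m' (lshift n j) = (m (lshift n j) - ((i == j) + (s i == j)))%N.
    by rewrite !mnmDE mnmBE mnmDE !mnm1E !eq_lshift !eq_rlshift !addn0.
  rewrite ltnS in lt_m_d; apply: leq_trans lt_m_d.
  rewrite (bigD1 i) // [ltnRHS](bigD1 i) //= -addSn leq_add //.
    by rewrite m'E eqxx (negbTE si); lia.
  by apply: leq_sum => j _; rewrite m'E leq_subr.
exists (- c), m''; split=> //.
have -> : 'X_[m] - (- c) *: 'X_[m''] =
    'X_[m - g] * (xvar K i * xvar K (s i) + yvar K i * yvar K (s i)) +
    (-1) * ('X_[m'] - c *: 'X_[m'']).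
  rewrite scaleNr /xvar /yvar mulrDr -!mpolyXD (submK le_gm) mulN1r opprB opprK.
  by rewrite -/m' -addrA [_ + (_ - _)]addrC subrK.
apply: ideal_genMD; last exact: ideal_genM.
exact: (mem_ideal_gen _ (i := (i, s i)) (s_edge i si)).
Qed.

Lemma standard_congr (K : fieldType) n (h : rel 'I_n) (s : 'I_n -> 'I_n) :
  (forall i, s i != i -> h i (s i)) ->
  forall p : {mpoly K[n + n]}, exists2 q : {mpoly K[n + n]},
    {subset msupp q <= standard s} & p - q \in L_ideal K n h.
Proof.
move=> s_edge; elim/mpolyind => [|c m p _ _ [q q_std pq_L]].
  by exists 0; rewrite ?subrr ?ideal_gen0 // => m; rewrite msupp0.
have [c' [m' [m'_std m'_L]]] := standard_congr_mnm K s_edge m.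
exists ((c * c') *: 'X_[m'] + q).
  move=> k /msuppD_le; rewrite mem_cat => /orP[/msuppZ_le|/q_std//].
  by rewrite msuppX inE => /eqP->.
rewrite opprD addrACA -scalerA -scalerBr -mul_mpolyC.
exact: ideal_genMD.
Qed.

(** No cancellation can occur between the images of distinct standard
    monomials, so each coefficient of q can be read off, up to sign, from a
    coefficient of its image. *)
Lemma segre_standard_eq0 (K : fieldType) n (s : 'I_n -> 'I_n)
  (q : {mpoly K[n + n]}) :
  involutive s -> {subset msupp q <= standard s} -> segre K s q = 0 -> q = 0.
Proof.
move=> sK q_std; rewrite {1}[q]mpolyE raddf_sum /= => q0.
apply/mpolyP => m; rewrite mcoeff0; apply/eqP; apply/negPn.
rewrite -mcoeff_msupp; apply/negP => m_q.
have /(congr1 (mcoeff (segre_mnm s m)))/eqP := q0.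
rewrite mcoeff0 raddf_sum (bigD1_seq m) ?msupp_uniq //= -[X in _ + X]big_filter.
rewrite big_seq big1 => [|k];
  rewrite ?mem_filter -[mmap _ _ _]/(segre K s _) segreZ segreX.
  rewrite addr0 !mcoeffZ mcoeffX eqxx mulr1 mulf_eq0.
  rewrite (negbTE (segre_coef_neq0 _ _ _)).
  by rewrite orbF mcoeff_eq0 m_q.
case/andP=> km k_q; rewrite !mcoeffZ mcoeffX.
by rewrite (inj_in_eq (segre_mnm_inj sK)) ?q_std // (negbTE km) !mulr0.
Qed.

(** * The ideal of a matching is a kernel *)

Lemma L_ideal_ker (K : fieldType) n (h : rel 'I_n) (s : 'I_n -> 'I_n) :
  involutive s -> (forall i j, h i j = (i != j) && (s i == j)) ->
  forall p, (p \in L_ideal K n h) = (segre K s p == 0).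
Proof.
move=> sK hE.
have L_ker : {in L_ideal K n h, forall p : {mpoly K[n + n]}, segre K s p = 0}.
  apply: rmorph_ideal_gen0 => -[i j]; rewrite hE /= => /andP[ij /eqP sij].
  by rewrite -sij in ij *; apply: segre_generator.
have s_edge i : s i != i -> h i (s i) by rewrite hE eqxx andbT eq_sym.
(* Reduce p to standard form q: then q is in the kernel too, so it is 0. *)
move=> p; apply/idP/eqP => [/L_ker//|p0].
have [q q_std pq_L] := standard_congr s_edge p.
suff q0 : q = 0 by rewrite q0 subr0 in pq_L.
apply: (segre_standard_eq0 sK q_std).
have := L_ker _ pq_L; rewrite rmorphB p0 sub0r => /eqP.
by rewrite oppr_eq0 => /eqP.
Qed.

Lemma prime_L_idealP (K : fieldType) n (h : rel 'I_n) :
  ssrbool.symmetric h -> irreflexive h ->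
  is_prime_ideal (L_ideal K n h) <-> is_matching h.
Proof.
move=> h_sym h_irr; split; first exact: prime_L_ideal_matching.
move=> /(matching_involution h_sym h_irr)[s sK hE].
exact: ker_prime_ideal (L_ideal_ker sK hE).
Qed.

Theorem corollary1p5 (K : fieldType)
  (hK : [pchar K] =i pred0 \/
        exists p : nat, [/\ p \in [pchar K],
                            (p <> 1 %[mod 4])%N & (p <> 2 %[mod 4])%N])
  (n : nat) (G : rel 'I_n) (Gsym : ssrbool.symmetric G) (Girr : irreflexive G) :
  is_prime_ideal (L_ideal K n (compl_graph G)) <->
  k_connected G (n%:Z - 2%:Z).
Proof.
rewrite -[in n%:Z](card_ord n) k_connected_codim2P //.
apply: prime_L_idealP => [i j|i]; rewrite /compl_graph /= ?eqxx //.
by rewrite eq_sym Gsym.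
Qed.
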